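(* Let $\mathcal{C}$ be an equational class of algebras of the same type, $A$ and $B$ algebras from $\mathcal{C}$, $f:A\to B$ a morphism in $\mathcal{C}$ and $i:f(A)\to B$ the canonical embedding (inclusion of the image subalgebra). Then: (1) if $\mathcal{C}$ is congruence-modular, then $f$ is admissible iff $i$ is admissible; (2) $f$ is Max-admissible iff $i$ is Max-admissible.
   Context: All algebras are non-empty. For an algebra $M$, $\mathrm{Con}(M)$ is the lattice of congruences of $M$, ordered by inclusion, with greatest element $\nabla_M=M^2$ and join $\vee$; $\mathrm{Max}(M)$ is the set of maximal elements of $\mathrm{Con}(M)\setminus\{\nabla_M\}$. An equational class is congruence-modular if $\mathrm{Con}(M)$ is a modular lattice for each of its members $M$. For a morphism $g:M\to N$, $\alpha\in\mathrm{Con}(M)$ and $\psi\in\mathrm{Con}(N)$, put $g(\alpha)=\{(g(a),g(b)) : (a,b)\in\alpha\}$, $g^*(\psi)=\{(a,b)\in M^2 : (g(a),g(b))\in\psi\}\in\mathrm{Con}(M)$ and $\mathrm{Ker}(g)=\{(a,b)\in M^2 : g(a)=g(b)\}$. If $\mathcal{C}$ is congruence-modular, the commutators $[\cdot,\cdot]_M$ of the members $M$ of $\mathcal{C}$ are the uniquely determined binary operations on $\mathrm{Con}(M)$ such that, for all $\alpha,\beta\in\mathrm{Con}(M)$, $[\alpha,\beta]_M$ is the least $\mu\in\mathrm{Con}(M)$ such that $\mu\subseteq\alpha\cap\beta$ and, for every algebra $N$ in $\mathcal{C}$ and every surjective morphism $h:M\to N$, $\mu\vee\mathrm{Ker}(h)=h^*([h(\alpha\vee\mathrm{Ker}(h)),h(\beta\vee\mathrm{Ker}(h))]_N)$.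 In that case, a congruence $\phi\neq\nabla_M$ of $M$ is prime if, for all $\alpha,\beta\in\mathrm{Con}(M)$, $[\alpha,\beta]_M\subseteq\phi$ implies $\alpha\subseteq\phi$ or $\beta\subseteq\phi$; $\mathrm{Spec}(M)$ is the set of prime congruences of $M$. A morphism $g:M\to N$ in a congruence-modular $\mathcal{C}$ is admissible if $g^*(\psi)\in\mathrm{Spec}(M)$ for all $\psi\in\mathrm{Spec}(N)$. A morphism $g:M\to N$ is Max-admissible if $g^*(\psi)\in\mathrm{Max}(M)$ for all $\psi\in\mathrm{Max}(N)$. *)

(* Defs.v *)
From HB Require Import structures.
From mathcomp Require Import all_boot all_order.
From mathcomp Require Import boolp classical_sets functions.

Set Implicit Arguments.
Unset Strict Implicit.
Unset Printing Implicit Defensive.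

Import Order.TTheory.

Local Open Scope classical_set_scope.
Local Open Scope order_scope.

#[local] Obligation Tactic := idtac.

(** * Algebras of a fixed finitary type *)

Record signature := Signature { opsym : Type; arity : opsym -> nat }.

Record algebra (S : signature) := Algebra {
  carrier :> Type;
  op : forall o : opsym S, ('I_(arity o) -> carrier) -> carrier;
  algebra_nonempty : inhabited carrier }.
Arguments op {S} a o args.

Record hom (S : signature) (M N : algebra S) := Hom {
  hom_fun :> M -> N;
  hom_op : forall (o : opsym S) (x : 'I_(arity o) -> M),
    hom_fun (op M o x) = op N o (hom_fun \o x) }.

(** * Equational classes *)

Inductive term (S : signature) : Type :=
| Var of nat
| App (o : opsym S) of ('I_(arity o) -> term S).

Fixpoint eval (S : signature) (M : algebra S) (v : nat -> M) (t : term S) : M :=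
  match t with
  | Var n => v n
  | App o args => op M o (fun i => eval v (args i))
  end.

Definition satisfies (S : signature) (M : algebra S) (e : term S * term S) :=
  forall v : nat -> M, eval v e.1 = eval v e.2.

Definition models (S : signature) (E : set (term S * term S))
    (M : algebra S) :=
  forall e, E e -> satisfies M e.

Definition equational_class (S : signature) (C : algebra S -> Prop) :=
  exists E : set (term S * term S), forall M, C M <-> models E M.

(** * The lattice of congruences *)

Record Con (S : signature) (M : algebra S) := MkCon {
  con_rel :> set (M * M);
  con_refl : forall x, con_rel (x, x);
  con_sym : forall x y, con_rel (x, y) -> con_rel (y, x);
  con_trans : forall x y z,
    con_rel (x, y) -> con_rel (y, z) -> con_rel (x, z);
  con_op : forall (o : opsym S) (x y : 'I_(arity o) -> M),
    (forall i, con_rel (x i, y i)) -> con_rel (op M o x, op M o y) }.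

Section ConLattice.
Variables (S : signature) (M : algebra S).
Implicit Types alpha beta gamma : Con M.

Lemma con_inj alpha beta : con_rel alpha = con_rel beta -> alpha = beta.
Proof.
case: alpha beta => r1 p1 p2 p3 p4 [r2 q1 q2 q3 q4] /= e.
by subst r2; congr MkCon; exact: Prop_irrelevance.
Qed.

Program Definition con_meet alpha beta : Con M :=
  @MkCon S M (alpha `&` beta) _ _ _ _.
Next Obligation. by move=> *; split; exact: con_refl. Qed.
Next Obligation. by move=> ? ? ? ? [? ?]; split; exact: con_sym. Qed.
Next Obligation.
by move=> ? ? ? y ? [? ?] [? ?]; split; apply: (@con_trans _ _ _ _ y).
Qed.
Next Obligation.
by move=> ? ? ? ? ? h; split; apply: con_op => i; case: (h i).
Qed.

Program Definition con_join alpha beta : Con M := @MkCon S M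
  [set p | forall gamma,
     alpha `<=` gamma -> beta `<=` gamma -> con_rel gamma p] _ _ _ _.
Next Obligation. by move=> ? ? ? g _ _; exact: con_refl. Qed.
Next Obligation. by move=> ? ? ? ? h g ? ?; apply: con_sym; exact: h. Qed.
Next Obligation.
move=> ? ? ? y ? h1 h2 g ? ?.
by apply: (@con_trans _ _ _ _ y); [exact: h1|exact: h2].
Qed.
Next Obligation. by move=> ? ? ? ? ? h g ? ?; apply: con_op => i; exact: h. Qed.

Program Definition con_nabla : Con M := @MkCon S M [set: M * M] _ _ _ _.
Solve All Obligations with by [].

Definition con_le alpha beta : bool := `[< alpha `<=` beta >].

HB.instance Definition _ := gen_eqMixin (Con M).
HB.instance Definition _ := gen_choiceMixin (Con M).

Lemma con_le_refl : reflexive con_le.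
Proof. by move=> a; apply/asboolP. Qed.

Lemma con_le_anti : antisymmetric con_le.
Proof.
by move=> a b /andP[/asboolP ab /asboolP ba]; apply: con_inj; apply/seteqP.
Qed.

Lemma con_le_trans : transitive con_le.
Proof.
move=> b a c /asboolP ab /asboolP bc; apply/asboolP.
exact: subset_trans ab bc.
Qed.

Fact con_display : Order.disp_t. Proof. exact: Order.Disp tt tt. Qed.

HB.instance Definition _ := Order.Le_isPOrder.Build con_display (Con M)
  con_le_refl con_le_anti con_le_trans.

Lemma leConE alpha beta : (alpha <= beta) = `[< alpha `<=` beta >].
Proof. by []. Qed.

Lemma con_meetP alpha beta gamma :
  (alpha <= con_meet beta gamma) = (alpha <= beta) && (alpha <= gamma).
Proof.
apply/asboolP/andP => [h|[/asboolP h1 /asboolP h2]].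
  by split; apply/asboolP => p /h [].
by move=> p ap; split; [exact: h1|exact: h2].
Qed.

Lemma con_joinP alpha beta gamma :
  (con_join alpha beta <= gamma) = (alpha <= gamma) && (beta <= gamma).
Proof.
apply/asboolP/andP => [h|[/asboolP h1 /asboolP h2]].
  by split; apply/asboolP => p ap; apply: h => d h1 h2; [exact: h1|exact: h2].
by move=> p; apply.
Qed.

HB.instance Definition _ :=
  Order.POrder_MeetJoin_isLattice.Build con_display (Con M)
    con_meetP con_joinP.

Lemma con_le_nabla alpha : alpha <= con_nabla.
Proof. exact/asboolP. Qed.

HB.instance Definition _ := Order.hasTop.Build con_display (Con M) con_le_nabla.

End ConLattice.

Definition modular_lattice (d : Order.disp_t) (L : latticeType d) :=
  forall x y z : L, x <= z -> x `|` (y `&` z) = (x `|` y) `&` z.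

Definition congruence_modular (S : signature) (C : algebra S -> Prop) :=
  forall M : algebra S, C M -> modular_lattice (Con M : latticeType _).

Definition Max (S : signature) (M : algebra S) : set (Con M) :=
  [set phi | phi <> \top /\
     forall psi : Con M, psi <> \top -> phi <= psi -> psi = phi].
Arguments Max {S} M.

(** * Direct and inverse images of congruences *)

Section Images.
Variables (S : signature) (M N : algebra S) (g : hom M N).

Definition con_image (alpha : Con M) : set (N * N) :=
  (fun p => (g p.1, g p.2)) @` alpha.

Program Definition con_preimage (psi : Con N) : Con M := @MkCon S M
  [set p | con_rel psi (g p.1, g p.2)] _ _ _ _.
Next Obligation. by move=> ? ? /=; exact: con_refl. Qed.
Next Obligation. by move=> ? ? ? /=; exact: con_sym. Qed.
Next Obligation. by move=> ? ? y ? /=; exact: con_trans. Qed.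
Next Obligation. by move=> ? o x y h /=; rewrite !hom_op; exact: con_op. Qed.

Program Definition Ker : Con M := @MkCon S M [set p | g p.1 = g p.2] _ _ _ _.
Next Obligation. by []. Qed.
Next Obligation. by move=> ? ? /= ->. Qed.
Next Obligation. by move=> ? y ? /= -> ->. Qed.
Next Obligation.
by move=> o x y h /=; rewrite !hom_op; congr op; apply: funext => i; exact: h.
Qed.

Hypothesis g_surj : set_surj [set: M] [set: N] g.
Variables (alpha : Con M) (ker_alpha : Ker <= alpha).

Lemma con_imageE x y : con_image alpha (g x, g y) <-> con_rel alpha (x, y).
Proof.
split=> [[[a b] /= ab [ga gb]]|xy]; last by exists (x, y).
move/asboolP: ker_alpha => k.
have xa : con_rel alpha (x, a) by apply: k; rewrite /= ga.
have by_ : con_rel alpha (b, y) by apply: k; rewrite /= gb.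
by apply: con_trans by_; exact: con_trans ab.
Qed.

Lemma surj_preim (u : N) : exists x : M, g x = u.
Proof. by have [x _ xu] := @g_surj u I; exists x. Qed.

(* The direct image is an equivalence only under surjectivity and
   [Ker g <= alpha]. *)
Program Definition surj_image : Con N := @MkCon S N (con_image alpha) _ _ _ _.
Next Obligation.
by move=> u; have [x <-] := surj_preim u; apply/con_imageE; exact: con_refl.
Qed.
Next Obligation.
move=> u v; have [x <-] := surj_preim u; have [y <-] := surj_preim v.
by move=> /con_imageE h; apply/con_imageE; exact: con_sym.
Qed.
Next Obligation.
move=> u v w; have [x <-] := surj_preim u; have [y <-] := surj_preim v.
have [z <-] := surj_preim w => /con_imageE h1 /con_imageE h2.
by apply/con_imageE; exact: con_trans h2.
Qed.
Next Obligation.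
move=> o u v h.
have [x xu] := choice (fun i => surj_preim (u i)).
have [y yv] := choice (fun i => surj_preim (v i)).
have -> : u = g \o x by apply: funext => i /=; rewrite xu.
have -> : v = g \o y by apply: funext => i /=; rewrite yv.
rewrite -!hom_op; apply/con_imageE; apply: con_op => i.
by apply/con_imageE; rewrite xu yv.
Qed.

End Images.

(** * Commutators and prime congruences *)

Section Commutator.
Variable S : signature.

(* [comm M] is a binary operation on [Con M]; such a family is given on all
   algebras of the type, but only its values on members of [C] are ever
   constrained. *)
Implicit Type comm : forall M : algebra S, Con M -> Con M -> Con M.

Definition commutator_condition (C : algebra S -> Prop) comm (M : algebra S)
    (alpha beta mu : Con M) :=
  mu <= alpha `&` beta /\
  forall (N : algebra S), C N ->
  forall (h : hom M N) (hs : set_surj [set: M] [set: N] h),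
    mu `|` Ker h =
    con_preimage h (comm N
      (surj_image hs (leUr (Ker h) alpha : Ker h <= alpha `|` Ker h))
      (surj_image hs (leUr (Ker h) beta : Ker h <= beta `|` Ker h))).

(* The condition on [comm M alpha beta] involves the values of [comm] at all
   members of [C]: the whole family is characterized simultaneously.  Nothing
   else is required of it; uniqueness in particular is not assumed. *)
Definition is_commutator (C : algebra S -> Prop) comm :=
  forall M : algebra S, C M -> forall alpha beta : Con M,
    commutator_condition C comm alpha beta (comm M alpha beta) /\
    forall mu : Con M, commutator_condition C comm alpha beta mu ->
      comm M alpha beta <= mu.

Definition Spec comm (M : algebra S) : set (Con M) :=
  [set phi | phi <> \top /\
     forall alpha beta : Con M,
       comm M alpha beta <= phi -> alpha <= phi \/ beta <= phi].

Definition admissible comm (M N : algebra S) (g : hom M N) :=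
  forall psi : Con N, Spec comm psi -> Spec comm (con_preimage g psi).

Definition Max_admissible (M N : algebra S) (g : hom M N) :=
  forall psi : Con N, Max N psi -> Max M (con_preimage g psi).

End Commutator.
Arguments Spec {S} comm M.

(** * The image subalgebra and its inclusion *)

Section ImageAlgebra.
Variables (S : signature) (M N : algebra S) (g : hom M N).

Lemma range_op (o : opsym S) (y : 'I_(arity o) -> {u : N | u \in range g}) :
  op N o (fun i => sval (y i)) \in range g.
Proof.
have /choice[x xy] : forall i, exists x, g x = sval (y i).
  by move=> i; have /set_mem[x _ xy] := svalP (y i); exists x.
apply/mem_set; exists (op M o x) => //.
by rewrite hom_op; congr op; apply: funext => i /=.
Qed.

Lemma range_inhabited : inhabited ({u : N | u \in range g}).
Proof.
have [x] := algebra_nonempty M.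
by constructor; exists (g x); apply/mem_set; exists x.
Qed.

Definition image_algebra : algebra S :=
  @Algebra S {u : N | u \in range g}
    (fun o y => exist (fun u : N => u \in range g) _ (range_op y))
    range_inhabited.

Definition image_incl : hom image_algebra N :=
  @Hom S image_algebra N (fun y => sval y) (fun o y => erefl).

End ImageAlgebra.

(* Main.v *)
Require Import Defs.
From mathcomp Require Import all_boot all_order.
From mathcomp Require Import boolp classical_sets functions.

(** The morphism [f] factors as the inclusion [i] after its surjective
    corestriction [p : A -> f(A)], so that [f^* = p^* \o i^*].  By the
    correspondence theorem [p^*] is an isomorphism from [Con f(A)] onto the
    interval above [Ker p], and the defining condition of the commutator makes
    it compatible with commutators modulo [Ker p]; hence [p^* phi] is maximal
    (resp. prime) exactly when [phi] is. *)

Set Implicit Arguments.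
Unset Strict Implicit.
Unset Printing Implicit Defensive.

Import Order.TTheory.

Local Open Scope classical_set_scope.
Local Open Scope order_scope.

Lemma hom_eval (S : signature) (M N : algebra S) (h : hom M N)
    (v : nat -> M) (t : term S) : h (eval v t) = eval (h \o v) t.
Proof.
elim: t => [//|o args IH] /=.
by rewrite hom_op; congr op; apply: funext => i /=.
Qed.

Lemma models_inj (S : signature) (E : set (term S * term S))
    (M N : algebra S) (h : hom M N) :
  injective h -> models E N -> models E M.
Proof.
by move=> h_inj EN e Ee v; apply: h_inj; rewrite !hom_eval; exact: EN.
Qed.

(** Needed because the commutator condition speaks only of quotient maps onto members of [C]. The
    image inherits the identities of [N] through its injective inclusion. *)
Lemma equational_class_image (S : signature) (C : algebra S -> Prop)
    (M N : algebra S) (g : hom M N) :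
  equational_class C -> C N -> C (image_algebra g).
Proof.
move=> [E CE] /CE EN; apply/CE.
by apply: (models_inj (h := image_incl g)) EN => x y; exact: val_inj.
Qed.

Section Corestriction.
Variables (S : signature) (M N : algebra S) (g : hom M N).

Definition corestr_fun (x : M) : image_algebra g :=
  exist (fun u : N => u \in range g) (g x)
    (mem_set (ex_intro2 (fun z => [set: M] z) (fun z => g z = g x) x I erefl)).

Lemma corestr_op (o : opsym S) (x : 'I_(arity o) -> M) :
  corestr_fun (op M o x) = op (image_algebra g) o (corestr_fun \o x).
Proof. by apply: val_inj; rewrite /= hom_op. Qed.

Definition corestr : hom M (image_algebra g) := Hom corestr_op.

Lemma corestr_surj : set_surj [set: M] [set: image_algebra g] corestr.
Proof.
by move=> [u gu] _; have [x _ xu] := set_mem gu; exists x => //; exact: val_inj.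
Qed.

(** Both underlying relations are convertible, as the inclusion after [corestr] computes to [g]. *)
Lemma con_preimage_factor (psi : Con N) :
  con_preimage g psi = con_preimage corestr (con_preimage (image_incl g) psi).
Proof. exact: con_inj. Qed.

End Corestriction.

Lemma Ker_le_preimage (S : signature) (M N : algebra S) (h : hom M N)
    (phi : Con N) : Ker h <= con_preimage h phi.
Proof. by apply/asboolP => -[x y] /= ->; exact: con_refl. Qed.

Section Surjective.
Variables (S : signature) (M N : algebra S) (h : hom M N).
Hypothesis hs : set_surj [set: M] [set: N] h.

Lemma le_con_preimage (phi psi : Con N) :
  (con_preimage h phi <= con_preimage h psi) = (phi <= psi).
Proof.
apply/asboolP/asboolP => le_pp; last by move=> -[x y]; exact: le_pp.
move=> [u v]; have [x <-] := surj_preim hs u; have [y <-] := surj_preim hs v.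
exact: (le_pp (x, y)).
Qed.

Lemma con_preimage_inj : injective (@con_preimage S M N h).
Proof.
by move=> phi psi e; apply: le_anti; rewrite -!le_con_preimage e lexx.
Qed.

Lemma con_preimage_top : con_preimage h \top = \top.
Proof. exact: con_inj. Qed.

Lemma con_preimage_neq_top (phi : Con N) :
  con_preimage h phi <> \top <-> phi <> \top.
Proof.
split=> ne e; apply: ne; first by rewrite e con_preimage_top.
by apply: con_preimage_inj; rewrite con_preimage_top.
Qed.

(** A congruence above the kernel is saturated: two points are related as soon as their images are
    images of related points. *)
Lemma surj_imageK (alpha : Con M) (k : Ker h <= alpha) :
  con_preimage h (surj_image hs k) = alpha.
Proof.
by apply: con_inj; apply/seteqP; split=> -[x y] xy; apply/(con_imageE k).
Qed.

(** The join with [Ker h], absorbed by the inverse image, is kept because the commutator condition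
    takes direct images of such joins. *)
Lemma con_preimageK (phi : Con N)
    (k : Ker h <= con_preimage h phi `|` Ker h) :
  surj_image hs k = phi.
Proof.
apply: con_preimage_inj; rewrite surj_imageK.
by apply/join_idPl; exact: Ker_le_preimage.
Qed.

Lemma Max_con_preimage (phi : Con N) :
  Max M (con_preimage h phi) <-> Max N phi.
Proof.
split=> -[/con_preimage_neq_top ne max]; split=> //.
  move=> psi /con_preimage_neq_top neq; rewrite -le_con_preimage => le_pp.
  exact/con_preimage_inj/max.
move=> psi neq le_pp.
(* Lying above the kernel, [psi] is the inverse image of its own direct image, to which maximality
   of [phi] applies. *)
have k : Ker h <= psi by apply: le_trans le_pp; exact: Ker_le_preimage.
move: neq le_pp; rewrite -(surj_imageK k) => /con_preimage_neq_top neq.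
by rewrite le_con_preimage => /(max _ neq) ->.
Qed.

Lemma Spec_con_preimage (C : algebra S -> Prop)
    (comm : forall M : algebra S, Con M -> Con M -> Con M) (phi : Con N) :
  is_commutator C comm -> C M -> C N ->
  Spec comm M (con_preimage h phi) <-> Spec comm N phi.
Proof.
move=> hcomm CM CN.
have commE alpha beta := (hcomm M CM alpha beta).1.2 N CN h hs.
split=> -[/con_preimage_neq_top ne prime]; split=> //.
  move=> gamma delta le_phi.
  (* Primeness is tested on the inverse images of [gamma] and [delta]; by [commE], their commutator
     joined with [Ker h] is the inverse image of that of [gamma] and [delta]. *)
  rewrite -(le_con_preimage gamma) -(le_con_preimage delta); apply: prime.
  apply: le_trans (leUl _ (Ker h)) _.
  by rewrite commE !con_preimageK le_con_preimage.
move=> alpha beta le_phi.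
(* Adding the kernel costs nothing below an inverse image and gives the left side of [commE]. *)
have : comm M alpha beta `|` Ker h <= con_preimage h phi.
  by rewrite leUx le_phi Ker_le_preimage.
rewrite commE le_con_preimage => /prime.
rewrite -!le_con_preimage !surj_imageK !leUx.
by case=> /andP[le_pre _]; [left|right].
Qed.

End Surjective.

Theorem proposition8p5 (S : signature) (C : algebra S -> Prop)
  (hC : equational_class C) (A B : algebra S) (hA : C A) (hB : C B)
  (f : hom A B) :
  (congruence_modular C ->
   forall comm : (forall M : algebra S, Con M -> Con M -> Con M),
     is_commutator C comm ->
     (admissible comm f <-> admissible comm (image_incl f))) /\
  (Max_admissible f <-> Max_admissible (image_incl f)).
Proof.
have hs := @corestr_surj S A B f.
split=> [_ comm hcomm|].
  have CI := equational_class_image f hC hB.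
  have specE phi := Spec_con_preimage hs phi hcomm hA CI.
  (* For each [psi], its inverse images under [f] and under the inclusion are prime
     simultaneously. *)
  by split=> adm psi /adm; rewrite (con_preimage_factor f) => /specE.
have maxE := Max_con_preimage hs.
by split=> adm psi /adm; rewrite (con_preimage_factor f) => /maxE.
Qed.
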